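(* Let $D\ge 1$ and let $g\in C^\infty$ be a Riemannian metric on $\mathbb{R}^D$ written as $g_x(u,v)=u^{\top}H(x)v$, such that there exist $c_1,c_2>0$ with $c_1\|u\|_2^2\le g_x(u,u)\le c_2\|u\|_2^2$ for all $x,u$, and $L_H\ge0$ with $\|H(x)-H(y)\|_{\mathcal{B}}\le L_H\|x-y\|_2$ for all $x,y$. Let $X^{(0)},X^{(1)}\subset\mathbb{R}^D$ be non-empty closed sets, at least one bounded. Then there exists a constant $C$ depending only on $c_1,c_2,L_H,d^g(X^{(0)},X^{(1)}),X^{(0)},X^{(1)}$ such that for every $N\ge1$ and every minimizer $\gamma^{*\mathrm{p}}_{\mathrm{l},N}\in\operatorname{argmin}_{\gamma^{\mathrm{p}}\in\mathcal{C}^N_{\mathrm{p}}(X^{(0)},X^{(1)})}\mathcal{E}^g_{\mathrm{l},N}(\gamma^{\mathrm{p}})$ with linear interpolation $\gamma^{*\mathrm{pl}}_{\mathrm{l},N}$, $$\mathcal{L}^g(\gamma^{*\mathrm{pl}}_{\mathrm{l},N})^2-\min_{\gamma\in\mathcal{C}_{\mathrm{ps}}(X^{(0)},X^{(1)})}\mathcal{L}^g(\gamma)^2\le\frac{C}{N^{1/2}}.$$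
   Context: $\|\cdot\|_2$ is the Euclidean norm and $\|A\|_{\mathcal{B}}$ the operator norm. $\mathcal{C}_{\mathrm{ps}}$ is the set of continuous piecewise $C^1$ curves $[0,1]\to\mathbb{R}^D$; $\mathcal{C}_{\mathrm{ps}}(X^{(0)},X^{(1)})$ those with $\gamma(0)\in X^{(0)},\gamma(1)\in X^{(1)}$. $\mathcal{E}^g(\gamma)=\int_0^1 g_{\gamma}(\dot\gamma,\dot\gamma)dt$, $\mathcal{L}^g(\gamma)=\int_0^1 g_\gamma(\dot\gamma,\dot\gamma)^{1/2}dt$, $d^g(x,y)=\inf\{\mathcal{L}^g(\gamma):\gamma\in\mathcal{C}_{\mathrm{ps}},\gamma(0)=x,\gamma(1)=y\}$, $d^g(X^{(0)},X^{(1)})=\inf_{x\in X^{(0)},y\in X^{(1)}}d^g(x,y)$. For $N\ge1$: $t_n=n/N$, $h=1/N$; $\mathcal{C}^N_{\mathrm{p}}(X^{(0)},X^{(1)})$ is the set of maps $\gamma^{\mathrm{p}}:\{t_0,\dots,t_N\}\to\mathbb{R}^D$ with $\gamma^{\mathrm{p}}(0)\in X^{(0)},\gamma^{\mathrm{p}}(1)\in X^{(1)}$; $\beta^{\mathrm{p}}(t_n)=(\gamma^{\mathrm{p}}(t_{n+1})-\gamma^{\mathrm{p}}(t_n))/h$; linear interpolation $\gamma^{\mathrm{pl}}(t_n+s)=(1-Ns)\gamma^{\mathrm{p}}(t_n)+Ns\gamma^{\mathrm{p}}(t_{n+1})$, $0\le s\le h$; $\mathcal{E}^g_{\mathrm{l},N}(\gamma^{\mathrm{p}})=\frac1N\sum_{n=0}^{N-1}g_{\gamma^{\mathrm{p}}(t_n)}(\beta^{\mathrm{p}}(t_n),\beta^{\mathrm{p}}(t_n))$.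 *)

(* Defs.v *)
From HB Require Import structures.
From mathcomp Require Import all_boot all_order all_algebra.
From mathcomp Require Import all_classical all_reals all_analysis.
Set Implicit Arguments. Unset Strict Implicit. Unset Printing Implicit Defensive.
Import Order.TTheory GRing.Theory Num.Theory.
Import numFieldNormedType.Exports.
Local Open Scope classical_set_scope.
Local Open Scope ring_scope.

Section Defs.
Variables (R : realType) (D : nat).
Notation vec := 'cV[R]_D.
Notation mat := 'M[R]_D.

Definition norm2 (u : vec) : R := Num.sqrt (\sum_(i < D) u i 0 ^+ 2).

Definition opnorm (A : mat) : R :=
  sup [set norm2 (A *m u) | u in [set u : vec | norm2 u <= 1]].

Definition gmet (H : vec -> mat) (x u v : vec) : R := ((u^T *m H x *m v) 0 0).

Fixpoint iterD (vs : seq vec) (H : vec -> mat) : vec -> mat :=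
  if vs is v :: vs' then (fun x => 'D_v (iterD vs' H) x) else H.

Definition smooth_field (H : vec -> mat) : Prop :=
  forall (vs : seq vec) (x : vec), differentiable (iterD vs H) x.

Definition C1_curve (phi : R -> vec) : Prop :=
  (forall t, derivable phi t 1) /\ continuous ('D_1 phi).

(* continuous piecewise C^1 curves [0,1] -> R^D: there is a partition
   0 = s_0 < s_1 < ... < s_k = 1 such that on each [s_j, s_{j+1}] the curve
   coincides with a C^1 map (i.e. its restriction is C^1 up to the ends). *)
Definition piecewise_C1 (gam : R -> vec) : Prop :=
  {within `[0, 1], continuous gam} /\
  exists s : seq R, [/\ sorted <%R (0 :: s), last 0 s = 1 &
    forall j, (j < size s)%N ->
      exists phi : R -> vec, C1_curve phi /\
        forall t, nth 0 (0 :: s) j <= t <= nth 0 (0 :: s) j.+1 ->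
          gam t = phi t].

Definition Cps (X0 X1 : set vec) : set (R -> vec) :=
  [set gam | piecewise_C1 gam /\ X0 (gam 0) /\ X1 (gam 1)].

(* length L^g(gamma) = int_0^1 g_gamma(gamma', gamma')^(1/2) dt
   (Lebesgue integral; the derivative is ignored on the null set of
   breakpoints) *)
Definition Lg (H : vec -> mat) (gam : R -> vec) : R :=
  fine (\int[lebesgue_measure]_(t in `[0%R, 1%R]) (Num.sqrt
      (gmet H (gam t) ('D_1 gam t) ('D_1 gam t)))%:E)%E.

Definition dg_pt (H : vec -> mat) (x y : vec) : R :=
  inf [set Lg H gam | gam in [set gam | piecewise_C1 gam /\ gam 0 = x /\ gam 1 = y]].

Definition dg_set (H : vec -> mat) (X0 X1 : set vec) : R :=
  inf [set dg_pt H x y | x in X0 & y in X1].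

(* discrete curves: gp n = gamma^p(t_n), n = 0..N (values beyond N unused) *)
Definition Cp (N : nat) (X0 X1 : set vec) : set (nat -> vec) :=
  [set gp | X0 (gp 0%N) /\ X1 (gp N)].

Definition betap (N : nat) (gp : nat -> vec) (n : nat) : vec :=
  N%:R *: (gp n.+1 - gp n).

Definition El (H : vec -> mat) (N : nat) (gp : nat -> vec) : R :=
  N%:R^-1 * \sum_(0 <= n < N) gmet H (gp n) (betap N gp n) (betap N gp n).

Definition interp (N : nat) (gp : nat -> vec) (t : R) : vec :=
  let n := minn (Num.truncn (N%:R * t)) N.-1 in
  let s := t - n%:R / N%:R in
  (1 - N%:R * s) *: gp n + (N%:R * s) *: gp n.+1.

Definition is_argmin_El (H : vec -> mat) (N : nat) (X0 X1 : set vec)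
    (gp : nat -> vec) : Prop :=
  Cp N X0 X1 gp /\ forall q, Cp N X0 X1 q -> El H N gp <= El H N q.

End Defs.

(* Main.v *)
Require Import Defs.
From HB Require Import structures.
From mathcomp Require Import all_boot all_order all_algebra.
From mathcomp Require Import all_classical all_reals all_analysis.
From mathcomp Require Import measurable_realfun ring lra.
Set Implicit Arguments.
Unset Strict Implicit.
Unset Printing Implicit Defensive.
Import Order.TTheory GRing.Theory Num.Theory.
Import numFieldNormedType.Exports.
Local Open Scope classical_set_scope.
Local Open Scope ring_scope.

(* Put K = LH / c1, so that |v|_y <= (1 + K |x - y|) |v|_x for the norms |.|_x of
   the metric. Sampling any competitor curve of length L at N + 1 points equally
   spaced in arc length gives a discrete curve of energy at most
   L^2 (1 + O(1/N))^2, because each chord, measured in the metric frozen at its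
   starting point, exceeds the arc it spans by at most the factor 1 + O(1/N).
   Hence a discrete minimizer has energy at most L^2 + O(1/N). In particular its
   energy is bounded, so each of its steps has Euclidean size O(N^(-1/2)); on a
   step of that size freezing the metric costs a factor 1 + O(N^(-1/2)), and
   Jensen's inequality bounds the squared length of the interpolation by the
   discrete energy times the square of that factor. The constants are uniform
   because only competitors no longer than the segment between two fixed points
   of X0 and X1 matter. *)

(** * Bilinear forms, the Euclidean norm and the operator norm *)

Section QuadraticForms.
Context {R : realType} {D : nat}.
Implicit Types (u v w : 'cV[R]_D) (A S : 'M[R]_D).

(** [gmet H x] is [qf (H x)] by conversion and [qf 1%:M] is the Euclidean product, so one calculus
    serves both. *)
Definition qf S u v : R := (u^T *m S *m v) 0 0.

Lemma qfDl S u v w : qf S (u + v) w = qf S u w + qf S v w.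
Proof. by rewrite /qf linearD /= !mulmxDl mxE. Qed.

Lemma qfDr S u v w : qf S w (u + v) = qf S w u + qf S w v.
Proof. by rewrite /qf mulmxDr mxE. Qed.

Lemma qfZl S a u w : qf S (a *: u) w = a * qf S u w.
Proof. by rewrite /qf linearZ /= -!scalemxAl mxE. Qed.

Lemma qfZr S a u w : qf S w (a *: u) = a * qf S w u.
Proof. by rewrite /qf -scalemxAr mxE. Qed.

Lemma qfNr S u w : qf S w (- u) = - qf S w u.
Proof. by rewrite -scaleN1r qfZr mulN1r. Qed.

Lemma qfNl S u w : qf S (- u) w = - qf S u w.
Proof. by rewrite -scaleN1r qfZl mulN1r. Qed.

Lemma qfBr S u v w : qf S w (u - v) = qf S w u - qf S w v.
Proof. by rewrite qfDr qfNr. Qed.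

Lemma qf0r S w : qf S w 0 = 0.
Proof. by rewrite /qf mulmx0 mxE. Qed.

Lemma qfZ2 S a u : qf S (a *: u) (a *: u) = a ^+ 2 * qf S u u.
Proof. by rewrite qfZl qfZr mulrA expr2. Qed.

Lemma qfB_mx S A u v : qf (S - A) u v = qf S u v - qf A u v.
Proof. by rewrite /qf mulmxBr mulmxBl !mxE. Qed.

Lemma qfC S u v : S^T = S -> qf S u v = qf S v u.
Proof.
move=> Ssym; rewrite /qf -[in LHS](trmxK (u^T *m S *m v)) mxE.
by rewrite !trmx_mul trmxK Ssym mulmxA.
Qed.

Lemma qf_coord S u v : qf S u v = \sum_i \sum_j u j 0 * S j i * v i 0.
Proof.
rewrite /qf mxE; apply: eq_bigr => i _; rewrite mxE big_distrl /=.
by apply: eq_bigr => j _; rewrite mxE.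
Qed.

Lemma qf_mulmx S u v : qf 1%:M u (S *m v) = qf S u v.
Proof. by rewrite /qf mulmx1 mulmxA. Qed.

Lemma qf1E u v : qf 1%:M u v = \sum_i u i 0 * v i 0.
Proof. by rewrite /qf mulmx1 mxE; apply: eq_bigr => i _; rewrite mxE. Qed.

Lemma qf1_ge0 u : 0 <= qf 1%:M u u.
Proof. by rewrite qf1E sumr_ge0 // => i _; rewrite -expr2 sqr_ge0. Qed.

Lemma norm2E u : norm2 u = Num.sqrt (qf 1%:M u u).
Proof. by rewrite qf1E. Qed.

Lemma norm2_ge0 u : 0 <= norm2 u.
Proof. exact: sqrtr_ge0. Qed.

Lemma sqr_norm2 u : norm2 u ^+ 2 = qf 1%:M u u.
Proof. by rewrite norm2E sqr_sqrtr ?qf1_ge0. Qed.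

Lemma norm2Z a u : norm2 (a *: u) = `|a| * norm2 u.
Proof. by rewrite !norm2E qfZ2 sqrtrM ?sqr_ge0 // sqrtr_sqr. Qed.

Lemma norm2N u : norm2 (- u) = norm2 u.
Proof. by rewrite -scaleN1r norm2Z normrN1 mul1r. Qed.

Lemma norm2_eq0 u : norm2 u = 0 -> u = 0.
Proof.
move=> u0; have := sqr_norm2 u; rewrite u0 expr0n /= qf1E => /esym/eqP.
rewrite psumr_eq0 => [|i _]; last by rewrite -expr2 sqr_ge0.
move=> /allP uz; apply/matrixP => i j; rewrite ord1 mxE.
by have /implyP/(_ isT) := uz i (mem_index_enum i); rewrite mulf_eq0 orbb => /eqP.
Qed.

Lemma qf_CauchySchwarz S u v : S^T = S -> (forall w, 0 <= qf S w w) ->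
  qf S u v ^+ 2 <= qf S u u * qf S v v.
Proof.
move=> Ssym Spsd.
(* Positivity of the form at [qf S t t *: s - qf S s t *: t]; this gives the claim whenever one of
   the two vectors is not null. *)
have disc s t : 0 <= qf S t t * (qf S t t * qf S s s - qf S s t ^+ 2).
  have := Spsd (qf S t t *: s - qf S s t *: t).
  rewrite qfBr -scaleNr !qfDl !qfZl !qfZr (qfC t s Ssym).
  by move=> h; apply: le_trans h _; rewrite le_eqVlt; apply/orP; left; apply/eqP; ring.
have [v0|v0] := ltP 0 (qf S v v).
  by have := disc u v; rewrite pmulr_rge0 // subr_ge0 mulrC.
have [u0|u0] := ltP 0 (qf S u u).
  by have := disc v u; rewrite pmulr_rge0 // subr_ge0 (qfC v u Ssym).
have qv : qf S v v = 0 by apply/eqP; rewrite eq_le v0 Spsd.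
have qu : qf S u u = 0 by apply/eqP; rewrite eq_le u0 Spsd.
(* Both vectors are null: positivity at [u + v] and [u - v] forces the mixed term to vanish. *)
have := Spsd (u + v); have := Spsd (u - v).
rewrite -[- v]scaleN1r !qfDl !qfDr !qfZl !qfZr (qfC v u Ssym) qv qu => h1 h2.
have -> : qf S u v = 0 by lra.
by rewrite expr0n mulr0.
Qed.

Lemma qf_le_sqrt S u v : S^T = S -> (forall w, 0 <= qf S w w) ->
  qf S u v <= Num.sqrt (qf S u u) * Num.sqrt (qf S v v).
Proof.
move=> Ssym Spsd; rewrite -sqrtrM ?Spsd //.
apply: le_trans (ler_norm _) _; rewrite -sqrtr_sqr ler_sqrt ?mulr_ge0 ?Spsd //.
exact: qf_CauchySchwarz.
Qed.

Lemma dot_le_norm2 u v : qf 1%:M u v <= norm2 u * norm2 v.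
Proof. by rewrite !norm2E; apply: qf_le_sqrt; [rewrite trmx1|exact: qf1_ge0]. Qed.

(** Makes the supremum in [opnorm] a genuine upper bound. The bound is the Frobenius norm, by
    Cauchy-Schwarz on each row. *)
Lemma opnorm_set_bounded A :
  has_sup [set norm2 (A *m u) | u in [set u : 'cV[R]_D | norm2 u <= 1]].
Proof.
split; first by exists (norm2 (A *m 0)); exists 0 => //=;
  rewrite norm2E qf0r sqrtr0 ler01.
exists (Num.sqrt (\sum_i norm2 (row i A)^T ^+ 2)) => _ /= [u u1 <-].
rewrite /norm2 ler_sqrt; last by apply: sumr_ge0 => i _; rewrite sqr_ge0.
apply: ler_sum => i _.
have -> : (A *m u) i 0 = qf 1%:M (row i A)^T u.
  by rewrite qf1E mxE; apply: eq_bigr => j _; rewrite !mxE.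
apply: le_trans (@qf_CauchySchwarz _ _ _ _ qf1_ge0) _; first by rewrite trmx1.
rewrite -!sqr_norm2 ler_piMr ?sqr_ge0 // expr_le1 ?norm2_ge0 //.
Qed.

Lemma norm2_mulmx_le A u : norm2 (A *m u) <= opnorm A * norm2 u.
Proof.
have [u0|un0] := eqVneq (norm2 u) 0.
  by rewrite (norm2_eq0 u0) mulmx0 norm2E qf0r sqrtr0 mulr0.
have up : 0 < norm2 u by rewrite lt_neqAle eq_sym un0 norm2_ge0.
rewrite -ler_pdivrMr // mulrC.
apply: (sup_upper_bound (opnorm_set_bounded A)); exists ((norm2 u)^-1 *: u) => /=.
  by rewrite norm2Z ger0_norm ?invr_ge0 ?norm2_ge0 // mulVf.
by rewrite -scalemxAr norm2Z ger0_norm ?invr_ge0 ?norm2_ge0.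
Qed.

Lemma qf_opnorm A u : qf A u u <= opnorm A * norm2 u ^+ 2.
Proof.
rewrite -qf_mulmx; apply: le_trans (dot_le_norm2 _ _) _.
by rewrite expr2 mulrCA ler_wpM2l ?norm2_ge0 // norm2_mulmx_le.
Qed.

End QuadraticForms.

(** * Comparison of the metric norms at two base points *)

Section MetricComparison.
Context {R : realType} {D : nat}.
Variables (c1 c2 LH : R) (H : 'cV[R]_D -> 'M[R]_D).
Hypotheses (hc1 : 0 < c1) (hLH : 0 <= LH).
Hypothesis Hsym : forall x, (H x)^T = H x.
Hypothesis Hell :
  forall x u, c1 * norm2 u ^+ 2 <= gmet H x u u <= c2 * norm2 u ^+ 2.
Hypothesis Hlip : forall x y, opnorm (H x - H y) <= LH * norm2 (x - y).
Implicit Types x y u v : 'cV[R]_D.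

Definition mnorm x u : R := Num.sqrt (gmet H x u u).

Lemma gmet_ge0 x u : 0 <= gmet H x u u.
Proof.
have /andP[h _] := Hell x u; apply: le_trans h.
by rewrite mulr_ge0 ?sqr_ge0 // ltW.
Qed.

Lemma mnorm_ge0 x u : 0 <= mnorm x u.
Proof. exact: sqrtr_ge0. Qed.

Lemma sqr_mnorm x u : mnorm x u ^+ 2 = gmet H x u u.
Proof. by rewrite sqr_sqrtr ?gmet_ge0. Qed.

Lemma gmet_le_mnorm x u v : gmet H x u v <= mnorm x u * mnorm x v.
Proof. exact: (qf_le_sqrt u v (Hsym x) (gmet_ge0 x)). Qed.

Lemma norm2_le_mnorm x u : Num.sqrt c1 * norm2 u <= mnorm x u.
Proof.
have /andP[h _] := Hell x u.
rewrite -[norm2 u]ger0_norm ?norm2_ge0 // -sqrtr_sqr -sqrtrM ?(ltW hc1) //.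
exact: ler_wsqrtr.
Qed.

Lemma mnorm_le_norm2 x u : 0 <= c2 -> mnorm x u <= Num.sqrt c2 * norm2 u.
Proof.
move=> c20; have /andP[_ h] := Hell x u.
rewrite -[norm2 u]ger0_norm ?norm2_ge0 // -sqrtr_sqr -sqrtrM //.
exact: ler_wsqrtr.
Qed.

(** The Lipschitz bound controls the difference of the forms by a multiple of [norm2 u ^+ 2], and
    ellipticity turns this into a multiple of the form itself; hence the ratio [LH / c1]. *)
Lemma gmet_lipschitz x y u :
  gmet H y u u <= (1 + LH / c1 * norm2 (y - x)) * gmet H x u u.
Proof.
have -> : gmet H y u u = gmet H x u u + qf (H y - H x) u u.
  by rewrite qfB_mx addrC subrK.
rewrite mulrDl mul1r lerD2l; apply: le_trans (qf_opnorm _ _) _.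
have /andP[h _] := Hell x u.
apply: (@le_trans _ _ (LH * norm2 (y - x) * norm2 u ^+ 2)).
  by rewrite ler_wpM2r ?sqr_ge0.
rewrite [_ / _ * _]mulrAC -[_ / c1 * _]mulrA ler_wpM2l ?mulr_ge0 ?norm2_ge0 //.
by rewrite mulrC ler_pdivlMr // mulrC.
Qed.

(** Square root of the previous estimate, with 1 + s <= (1 + s)^2 for s >= 0 to avoid a root in the
    factor. *)
Lemma mnorm_lipschitz x y u (r : R) : norm2 (y - x) <= r ->
  mnorm y u <= (1 + LH / c1 * r) * mnorm x u.
Proof.
move=> hr; have K0 : 0 <= LH / c1 by rewrite divr_ge0 // ltW.
have r0 : 0 <= r := le_trans (norm2_ge0 _) hr.
have Kr0 : 0 <= LH / c1 * r by rewrite mulr_ge0.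
rewrite -ler_sqr ?nnegrE ?mulr_ge0 ?mnorm_ge0 ?addr_ge0 //.
rewrite exprMn !sqr_mnorm; apply: le_trans (gmet_lipschitz x y u) _.
rewrite ler_wpM2r ?gmet_ge0 //.
apply: (@le_trans _ _ (1 + LH / c1 * r)); first by rewrite lerD2l ler_wpM2l.
by rewrite expr2 ler_peMr ?addr_ge0 // lerDl.
Qed.

End MetricComparison.

(** * Integrals over closed intervals, with endpoints treated as null sets *)

Section IntervalIntegrals.
Context {R : realType}.
Notation mu := (@lebesgue_measure R).
Implicit Types (F : R -> R) (a b c : R).

Lemma integrable_oo_cc F a b :
  mu.-integrable `]a, b[ (EFin \o F) -> mu.-integrable `[a, b] (EFin \o F).
Proof.
move=> /integrableP[mF iF].
have mF' := (emeasurable_fun_itv_bndo_bndcP _ _ _).1 mF.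
apply/integrableP; split; first exact/emeasurable_fun_itv_obnd_cbndP.
rewrite -integral_itv_obnd_cbnd; last exact: measurableT_comp.
rewrite -integral_itv_bndo_bndc //; exact: measurableT_comp.
Qed.

Lemma Rintegral_cc_oo F a b : mu.-integrable `[a, b] (EFin \o F) ->
  \int[mu]_(t in `[a, b]) F t = \int[mu]_(t in `]a, b[) F t.
Proof.
move=> iF.
rewrite -Rintegral_itv_obnd_cbnd; last first.
  by apply: integrableS iF => //; exact: subset_itv_oc_cc.
rewrite -Rintegral_itv_bndo_bndc //.
by apply: integrableS iF => //; exact: subset_itv_oo_cc.
Qed.

Lemma integrable_itv_cat F a b c : a <= b -> b <= c ->
  mu.-integrable `[a, b] (EFin \o F) -> mu.-integrable `[b, c] (EFin \o F) ->
  mu.-integrable `[a, c] (EFin \o F).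
Proof.
move=> ab bc iab ibc.
have ibc' : mu.-integrable `]b, c] (EFin \o F).
  by apply: integrableS ibc => //; exact: subset_itv_oc_cc.
rewrite (@itv_bndbnd_setU _ _ _ (BRight b)) ?bnd_simp //.
move: iab ibc' => /integrableP[m1 i1] /integrableP[m2 i2].
have mF := (measurable_funU (EFin \o F) (measurable_itv _) (measurable_itv _)).2
  (conj m1 m2).
apply/integrableP; split => //.
rewrite ge0_integral_setU //; first exact: lte_add_pinfty.
  exact: measurableT_comp.
apply/disj_setPS => y [/=]; rewrite !in_itv/= => /andP[_ yb] /andP[].
by rewrite ltNge yb.
Qed.

Lemma Rintegral_itv_cat F a b c : a <= b -> b <= c ->
  mu.-integrable `[a, c] (EFin \o F) ->
  \int[mu]_(t in `[a, c]) F t =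
  \int[mu]_(t in `[a, b]) F t + \int[mu]_(t in `[b, c]) F t.
Proof.
move=> ab bc iF.
have := @Rintegral_itvB _ F (BLeft a) (BRight c) b iF.
rewrite !bnd_simp => /(_ ab bc) h.
rewrite -[X in _ + X]Rintegral_itv_obnd_cbnd; first by rewrite -h addrC subrK.
by apply: integrableS iF => //; apply: subset_itv; rewrite bnd_simp.
Qed.

(** The bound is asked only in the interior, because the derivative of a piecewise curve is
    uncontrolled at breakpoints. *)
Lemma Rintegral_le_cst F a b M : a <= b ->
  mu.-integrable `[a, b] (EFin \o F) -> (forall t, a < t < b -> F t <= M) ->
  \int[mu]_(t in `[a, b]) F t <= M * (b - a).
Proof.
move=> ab iF FM.
have muab : mu `]a, b[ = (b - a)%:E.
  rewrite lebesgue_measure_itv /= lte_fin.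
  move: ab; rewrite le_eqVlt => /predU1P[->|-> //].
  by rewrite ltxx subrr.
rewrite Rintegral_cc_oo //.
have -> : M * (b - a) = \int[mu]_(t in `]a, b[) M.
  by rewrite Rintegral_cst //= muab.
apply: le_Rintegral => //.
- by apply: integrableS iF => //; exact: subset_itv_oo_cc.
- suff : mu.-integrable `[a, b] (EFin \o (fun=> M)).
    by apply: integrableS => //; exact: subset_itv_oo_cc.
  apply: continuous_compact_integrable; first exact: segment_compact.
  by apply: continuous_subspaceT => ?; exact: cvg_cst.
Qed.

End IntervalIntegrals.

(** * Speed and increments of piecewise C1 curves *)

Section Curves.
Context {R : realType} {D : nat}.
Notation mu := (@lebesgue_measure R).
Variables (H : 'cV[R]_D -> 'M[R]_D).
Hypothesis Hcont : continuous H.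

Definition speed (gam : R -> 'cV[R]_D) (t : R) : R :=
  mnorm H (gam t) ('D_1 gam t).

Lemma continuous_qf (T : topologicalType) (S : T -> 'M[R]_D)
    (u v : T -> 'cV[R]_D) :
  continuous S -> continuous u -> continuous v ->
  continuous (fun t => qf (S t) (u t) (v t)).
Proof.
move=> cS cu cv.
rewrite (funext (fun t => qf_coord (S t) (u t) (v t))) => t.
apply: cvg_big => [|i _]; first exact: add_continuous.
apply: cvg_big => [|j _]; first exact: add_continuous.
apply: cvgM; [apply: cvgM|].
- exact: (continuous_comp (cu t) (@coord_continuous _ _ _ j 0 _)).
- exact: (continuous_comp (cS t) (@coord_continuous _ _ _ j i _)).
- exact: (continuous_comp (cv t) (@coord_continuous _ _ _ i 0 _)).
Qed.

Lemma C1_curve_continuous (phi : R -> 'cV[R]_D) :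
  C1_curve phi -> continuous phi.
Proof.
by move=> [dphi _] t; apply/differentiable_continuous/derivable1_diffP.
Qed.

Lemma continuous_speed (phi : R -> 'cV[R]_D) :
  C1_curve phi -> continuous (speed phi).
Proof.
move=> Cphi t; have [dphi cphi] := Cphi.
have cp := C1_curve_continuous Cphi.
apply: (@continuous_comp _ _ _ (fun t => gmet H (phi t) ('D_1 phi t) ('D_1 phi t))
  Num.sqrt); last exact: sqrt_continuous.
apply: (@continuous_qf _ (H \o phi) ('D_1 phi) ('D_1 phi)) => //.
by move=> s; apply: continuous_comp; [exact: cp|exact: Hcont].
Qed.

Lemma is_derive_qf (S : 'M[R]_D) (w : 'cV[R]_D) (phi : R -> 'cV[R]_D) (t : R) :
  derivable phi t 1 ->
  is_derive t (1 : R) (fun s => qf S w (phi s)) (qf S w ('D_1 phi t)).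
Proof.
move=> dphi.
have E v : qf S w v = \sum_i (w^T *m S) 0 i *: v i 0 by rewrite /qf mxE.
rewrite E (_ : (fun s => _) = \sum_i (w^T *m S) 0 i \*: (fun s => phi s i 0)).
  apply: is_derive_sum => i; apply: is_deriveZ.
  rewrite derive_mx // mxE; apply: DeriveDef => //.
  by move/derivable_mxP : dphi.
by apply/funext => s; rewrite E fct_sumE.
Qed.

Section Piece.
Variables (gam phi : R -> 'cV[R]_D) (a b : R).
Hypothesis Cphi : C1_curve phi.
Hypothesis gamE : forall t, a <= t <= b -> gam t = phi t.

(** Restricted to the open interval: there the two curves agree on a neighbourhood, hence have the
    same derivative. *)
Lemma speed_piece t : a < t < b -> speed gam t = speed phi t.
Proof.
move=> /andP[at_ tb]; rewrite /speed gamE; last by rewrite (ltW at_) (ltW tb).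
congr mnorm; apply: near_eq_derive.
have : `]a, b[%classic t by rewrite /= in_itv /= at_ tb.
move=> /(itv_open a b); apply: filterS => s /=; rewrite in_itv /= => /andP[h1 h2].
by rewrite gamE // !ltW.
Qed.

Lemma integrable_speed_piece : mu.-integrable `[a, b] (EFin \o speed gam).
Proof.
apply: integrable_oo_cc.
suff : mu.-integrable `]a, b[ (EFin \o speed phi).
  apply: eq_integrable => [|t]; first by [].
  by rewrite inE /= in_itv /= => tab; rewrite speed_piece.
suff : mu.-integrable `[a, b] (EFin \o speed phi).
  by apply: integrableS => //; exact: subset_itv_oo_cc.
apply: continuous_compact_integrable; first exact: segment_compact.
by apply: continuous_subspaceT; exact: continuous_speed.
Qed.

(** The fundamental theorem of calculus is applied to the scalar function [qf S w] along the curve.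
    Taking [w] to be the increment itself later yields chord estimates, Euclidean for [S = 1%:M] and
    in a frozen metric for [S = H x]. *)
Lemma qf_increment_piece (S : 'M[R]_D) (w : 'cV[R]_D) (M : R) : a <= b ->
  (forall t, a <= t <= b -> forall h, qf S w h <= M * mnorm H (gam t) h) ->
  qf S w (gam b - gam a) <= M * \int[mu]_(t in `[a, b]) speed gam t.
Proof.
rewrite le_eqVlt => /predU1P[-> _|ab hM].
  by rewrite subrr qf0r set_itv1 Rintegral_set1 mulr0.
have [dphi cphi] := Cphi.
have cw : continuous (fun t => qf S w ('D_1 phi t)).
  by apply: (@continuous_qf _ (fun=> S) (fun=> w)) => // ?; exact: cvg_cst.
have cG : continuous (fun t => qf S w (phi t)).
  apply: (@continuous_qf _ (fun=> S) (fun=> w)) => //; try by move=> ?; exact: cvg_cst.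
  exact: C1_curve_continuous.
have FTC : \int[mu]_(t in `[a, b]) qf S w ('D_1 phi t) =
    qf S w (phi b) - qf S w (phi a).
  rewrite /Rintegral (continuous_FTC2 (F := fun t => qf S w (phi t)) ab) //.
  - by apply: continuous_subspaceT.
  - split => [t _|  |].
    + by have [] := is_derive_qf S w (dphi t).
    + exact/cvg_at_right_filter/cG.
    + exact/cvg_at_left_filter/cG.
  - by move=> t _; rewrite derive1E; have [_ ->] := is_derive_qf S w (dphi t).
have iF := integrable_speed_piece.
have iD : mu.-integrable `[a, b] (EFin \o (fun t => qf S w ('D_1 phi t))).
  apply: continuous_compact_integrable; first exact: segment_compact.
  exact: continuous_subspaceT.
have iMF : mu.-integrable `[a, b] (EFin \o (fun t => M * speed gam t)).
  rewrite (_ : EFin \o _ = fun t => (M%:E * (EFin \o speed gam) t)%E) //.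
  exact: integrableZl.
rewrite qfBr !gamE ?lexx ?(ltW ab) // -FTC -RintegralZl //.
rewrite !Rintegral_cc_oo //.
apply: le_Rintegral => //.
- by apply: integrableS iD => //; exact: subset_itv_oo_cc.
- by apply: integrableS iMF => //; exact: subset_itv_oo_cc.
- move=> t /=; rewrite in_itv /= => tab; rewrite speed_piece // /speed.
  have /andP[/ltW h1 /ltW h2] := tab.
  by rewrite -gamE ?h1 // hM ?h1.
Qed.

End Piece.

(** Induction on the breakpoints: two points on either side of [b] are linked through [b], and
    points on the same side fall to the first cell or to the induction hypothesis. *)
Lemma partition_chain (T : R -> R -> Prop) (a b : R) (s : seq R) :
  (forall u v w, u <= v -> v <= w -> T u v -> T v w -> T u w) ->
  (forall j, (j < (size s).+1)%N -> forall u v,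
     nth 0 (a :: b :: s) j <= u -> u <= v -> v <= nth 0 (a :: b :: s) j.+1 ->
     T u v) ->
  forall u v, a <= u -> u <= v -> v <= last b s -> T u v.
Proof.
move=> Ttrans; elim: s a b => [|c s IH] a b hT u v au uv vl.
  exact: (hT 0%N).
have hT' := IH b c (fun j hj => hT j.+1 hj).
have [vb|bv] := leP v b; first exact: (hT 0%N).
have [bu|ub] := leP b u; first exact: hT'.
apply: (Ttrans _ b) => //; try exact: ltW.
- by apply: (hT 0%N) => //; exact: ltW.
- by apply: hT' => //; exact: ltW.
Qed.

(** The covering of [0, 1] by C1 pieces, the form in which competitors and interpolations alike
    enter the estimates. *)
Definition pieces (gam : R -> 'cV[R]_D) : Prop :=
  exists2 s : seq R, last 0 s = 1 &
    forall j, (j < size s)%N ->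
      exists2 phi : R -> 'cV[R]_D, C1_curve phi &
        forall t, nth 0 (0 :: s) j <= t <= nth 0 (0 :: s) j.+1 ->
          gam t = phi t.

Lemma piecewise_C1_pieces (gam : R -> 'cV[R]_D) : piecewise_C1 gam -> pieces gam.
Proof.
move=> [_ [s [_ l1 hs]]]; exists s => // j hj.
by have [phi [Cphi E]] := hs j hj; exists phi.
Qed.

(** Integrability and the increment bound are carried together, since splitting the integral at a
    breakpoint requires integrability on the union. *)
Lemma pieces_chain (gam : R -> 'cV[R]_D) : pieces gam ->
  forall u v, 0 <= u -> u <= v -> v <= 1 ->
  mu.-integrable `[u, v] (EFin \o speed gam) /\
  forall S w M,
    (forall t, u <= t <= v -> forall h, qf S w h <= M * mnorm H (gam t) h) ->
    qf S w (gam v - gam u) <= M * \int[mu]_(t in `[u, v]) speed gam t.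
Proof.
move=> [[|b s]]; first by move=> /= /eqP; rewrite eq_sym oner_eq0.
move=> /= l1 hs u v u0 uv; rewrite -l1 => v1.
apply: (@partition_chain (fun u v =>
  mu.-integrable `[u, v] (EFin \o speed gam) /\
  forall S w M,
    (forall t, u <= t <= v -> forall h, qf S w h <= M * mnorm H (gam t) h) ->
    qf S w (gam v - gam u) <= M * \int[mu]_(t in `[u, v]) speed gam t) 0 b s)
  => // {u v u0 uv v1}.
- move=> u v w uv vw [i1 h1] [i2 h2].
  have i3 := integrable_itv_cat uv vw i1 i2.
  split=> // S x M hM; rewrite (Rintegral_itv_cat uv vw i3) mulrDr.
  rewrite -(subrK (gam v) (gam w)) -addrA qfDr [leLHS]addrC lerD //.
  + by apply: h1 => t /andP[ut tv]; apply: hM; rewrite ut (le_trans tv).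
  + by apply: h2 => t /andP[vt tw]; apply: hM; rewrite tw (le_trans uv).
- move=> j hj u v ju uv vj; have [phi Cphi E] := hs j hj.
  have E' t : u <= t <= v -> gam t = phi t.
    by move=> /andP[ut tv]; apply: E; rewrite (le_trans ju) // (le_trans tv).
  split; first exact: integrable_speed_piece Cphi E'.
  by move=> S w M; apply: qf_increment_piece Cphi E' _ _ _ uv.
Qed.

End Curves.

(** * Affine curves, parametrized so as to fit one cell of an interpolation *)

Section AffineCurves.
Context {R : realType} {D : nat}.
Implicit Types (x w : 'cV[R]_D) (a b : R).

Lemma is_derive_affine x w a b (t : R) :
  is_derive t (1 : R) (fun s => x + (a * s - b) *: w) (a *: w).
Proof.
have E i j : is_derive t (1 : R)
    (fun s => (x + (a * s - b) *: w) i j) (a * w i j).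
  rewrite (_ : (fun s => _) =
    cst (x i j) + (a *: (w i j \*: id)) - cst (b * w i j)).
    apply: is_derive_eq.
    by rewrite -[LHS]/(0 + a * (w i j * 1) - 0 :> R) add0r subr0 mulr1.
  apply/funext => s; rewrite !mxE.
  by rewrite -[RHS]/(x i j + a * (w i j * s) - b * w i j); ring.
have d : derivable (fun s => x + (a * s - b) *: w) t 1.
  by apply/derivable_mxP => i j; have [] := E i j.
apply: DeriveDef => //; rewrite derive_mx //; apply/matrixP => i j.
by rewrite mxE; have [_ ->] := E i j; rewrite mxE.
Qed.

Lemma derive_affine x w a b (t : R) :
  'D_1 (fun s => x + (a * s - b) *: w) t = a *: w.
Proof. by have [_ ->] := is_derive_affine x w a b t. Qed.

Lemma C1_affine x w a b : C1_curve (fun t => x + (a * t - b) *: w).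
Proof.
split=> [t|]; first by have [] := is_derive_affine x w a b t.
rewrite (funext (derive_affine x w a b)) => t; exact: cvg_cst.
Qed.

End AffineCurves.

(** * Linear interpolation of discrete curves *)

Section DiscreteCurves.
Context {R : realType} {D : nat}.
Variables (N : nat) (gp : nat -> 'cV[R]_D).
Hypothesis N0 : (0 < N)%N.

Lemma interp_affine n t : (n < N)%N ->
  n%:R / N%:R <= t <= n.+1%:R / N%:R ->
  interp N gp t = gp n + (N%:R * t - n%:R) *: (gp n.+1 - gp n).
Proof.
move=> nN /andP[h1 h2]; have Np : 0 < N%:R :> R by rewrite ltr0n.
rewrite ler_pdivrMr // mulrC in h1; rewrite ler_pdivlMr // mulrC in h2.
have Ns (k : nat) : N%:R * (t - k%:R / N%:R) = N%:R * t - k%:R.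
  by rewrite mulrBr mulrCA divff ?mulr1 // lt0r_neq0.
have aff k : (1 - (N%:R * t - k%:R)) *: gp k + (N%:R * t - k%:R) *: gp k.+1 =
    gp k + (N%:R * t - k%:R) *: (gp k.+1 - gp k).
  by rewrite scalerBl scale1r scalerBr -addrA [- _ + _]addrC.
rewrite /interp Ns aff.
(* At the right end of the cell the truncation jumps to [n.+1], or is capped at [N.-1 = n] in the
   last cell; both formulas give [gp n.+1]. *)
move: h2; rewrite le_eqVlt => /predU1P[h2|h2].
  rewrite h2 (@truncn_def _ _ n.+1) ?lexx ?ltr_nat ?ltnSn //.
  have [lt|] := ltnP n.+1 N; last first.
    move=> Nn; have NE : N = n.+1 by apply/eqP; rewrite eqn_leq Nn nN.
    by rewrite NE /= (minn_idPr _).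
  rewrite (minn_idPl _); last by rewrite -ltnS prednK.
  by rewrite subrr scale0r addr0 -natrB // subSnn scale1r addrC subrK.
rewrite (@truncn_def _ _ n) ?h1 //.
by rewrite (minn_idPl _) // -ltnS prednK.
Qed.

Lemma pieces_interp : pieces (interp N gp).
Proof.
pose s := mkseq (fun n => n.+1%:R / N%:R : R) N.
have nthE j : (j <= N)%N -> nth 0 (0 :: s) j = j%:R / N%:R.
  by case: j => [|j] hj /=; rewrite ?mul0r // nth_mkseq.
have sz : size s = N by rewrite size_mkseq.
exists s.
  by rewrite (last_nth 0) sz nthE // divff // pnatr_eq0 -lt0n.
move=> j; rewrite sz => hj.
exists (fun t => gp j + (N%:R * t - j%:R) *: (gp j.+1 - gp j)).
  exact: C1_affine.
by move=> t; rewrite !nthE // 1?ltnW //; exact: interp_affine.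
Qed.

End DiscreteCurves.

(** Cauchy-Schwarz in dimension [N] against the vector of ones: the discrete Jensen inequality. *)
Lemma sqr_mean_le {R : realType} (N : nat) (a : nat -> R) : (0 < N)%N ->
  (N%:R^-1 * \sum_(0 <= n < N) a n) ^+ 2 <= N%:R^-1 * \sum_(0 <= n < N) a n ^+ 2.
Proof.
move=> N0; have Np : 0 < N%:R :> R by rewrite ltr0n.
have := @qf_CauchySchwarz R N 1%:M (const_mx 1) (\col_i a i) (trmx1 _ _) qf1_ge0.
rewrite !qf1E !big_mkord.
under eq_bigr do rewrite !mxE mul1r.
under [X in _ <= X * _ -> _]eq_bigr do rewrite !mxE mul1r.
under [X in _ <= _ * X -> _]eq_bigr do rewrite !mxE -expr2.
rewrite sumr_const card_ord => h.
rewrite exprMn expr2 -mulrA ler_pM2l ?invr_gt0 //.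
by rewrite ler_pdivrMl.
Qed.

Lemma ler_sqr_cancel {R : realType} (p I : R) :
  0 <= p -> 0 <= I -> p * p <= p * I -> p <= I.
Proof.
by rewrite le_eqVlt => /predU1P[<- //|p0 I0]; rewrite ler_pM2l.
Qed.

(** * Arc length of curves against discrete energy *)

Section Lengths.
Context {R : realType} {D : nat}.
Notation mu := (@lebesgue_measure R).
Variables (c1 c2 LH : R) (H : 'cV[R]_D -> 'M[R]_D).
Hypotheses (hc1 : 0 < c1) (hLH : 0 <= LH).
Hypothesis Hcont : continuous H.
Hypothesis Hsym : forall x, (H x)^T = H x.
Hypothesis Hell :
  forall x u, c1 * norm2 u ^+ 2 <= gmet H x u u <= c2 * norm2 u ^+ 2.
Hypothesis Hlip : forall x y, opnorm (H x - H y) <= LH * norm2 (x - y).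

Let K := LH / c1.
Let sc1 := Num.sqrt c1.

Let K0 : 0 <= K. Proof. by rewrite divr_ge0 // ltW. Qed.
Let sc1p : 0 < sc1. Proof. by rewrite sqrtr_gt0. Qed.

Section OneCurve.
Variable gam : R -> 'cV[R]_D.
Hypothesis Pgam : pieces gam.

Definition arclen (u v : R) : R := \int[mu]_(t in `[u, v]) speed H gam t.

Lemma arclen_ge0 u v : 0 <= arclen u v.
Proof. by apply: Rintegral_ge0 => t _; exact: mnorm_ge0. Qed.

Lemma arclen_cat u v w : 0 <= u -> u <= v -> v <= w -> w <= 1 ->
  arclen u w = arclen u v + arclen v w.
Proof.
move=> u0 uv vw w1; apply: Rintegral_itv_cat => //.
by have [] := pieces_chain Hcont Pgam u0 (le_trans uv vw) w1.
Qed.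

(** The increment [w] is tested against itself in the Euclidean product; ellipticity allows the
    constant [norm2 w / sc1]. The factor [norm2 w], possibly zero, is then cancelled. *)
Lemma norm2_le_arclen u v : 0 <= u -> u <= v -> v <= 1 ->
  norm2 (gam v - gam u) <= arclen u v / sc1.
Proof.
move=> u0 uv v1; have [_ h] := pieces_chain Hcont Pgam u0 uv v1.
set w := gam v - gam u in h *.
apply: ler_sqr_cancel; rewrite ?norm2_ge0 ?divr_ge0 ?arclen_ge0 ?(ltW sc1p) //.
have := h 1%:M w (norm2 w / sc1); rewrite -expr2 sqr_norm2 => hh.
apply: le_trans (hh _) _; last by rewrite /arclen mulrAC mulrA.
move=> t _ z; apply: le_trans (dot_le_norm2 _ _) _.
rewrite -mulrA ler_wpM2l ?norm2_ge0 // ler_pdivlMl //.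
exact: norm2_le_mnorm Hell _ _.
Qed.

(** The same self-testing in the metric frozen at [x]: Cauchy-Schwarz there, then a change of base
    point from [x] to [gam t] at cost [1 + K * r]. *)
Lemma chord_le_arclen x (r : R) u v : 0 <= u -> u <= v -> v <= 1 ->
  (forall t, u <= t <= v -> norm2 (x - gam t) <= r) ->
  mnorm H x (gam v - gam u) <= (1 + K * r) * arclen u v.
Proof.
move=> u0 uv v1 hr; have [_ h] := pieces_chain Hcont Pgam u0 uv v1.
have r0 : 0 <= r := le_trans (norm2_ge0 _) (hr u ltac:(by rewrite lexx)).
have Kr : 0 <= 1 + K * r by rewrite addr_ge0 // mulr_ge0.
set w := gam v - gam u in h *.
apply: ler_sqr_cancel; rewrite ?mnorm_ge0 ?mulr_ge0 ?arclen_ge0 //.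
have := h (H x) w (mnorm H x w * (1 + K * r)).
rewrite -expr2 (sqr_mnorm hc1 Hell) => hh.
apply: le_trans (hh _) _; last by rewrite /arclen mulrA.
move=> t /hr ht z; apply: le_trans (gmet_le_mnorm hc1 Hsym Hell x w z) _.
rewrite -mulrA ler_wpM2l ?mnorm_ge0 //.
exact: mnorm_lipschitz.
Qed.

(** Stated for [u] and [v] in either order, because sample times supplied by the intermediate value
    theorem come with no monotonicity. The metric is frozen at [gam u] in both cases. *)
Lemma chord_le u v (d : R) : 0 <= u <= 1 -> 0 <= v <= 1 ->
  `|arclen 0 v - arclen 0 u| <= d ->
  mnorm H (gam u) (gam v - gam u) <= (1 + K * (d / sc1)) * d.
Proof.
move=> /andP[u0 u1] /andP[v0 v1] hd.
have d0 : 0 <= d := le_trans (normr_ge0 _) hd.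
have Kd : 0 <= 1 + K * (d / sc1).
  by rewrite addr_ge0 // mulr_ge0 // divr_ge0 // ltW.
have [uv|/ltW vu] := leP u v.
  have E : arclen u v <= d.
    move: hd; rewrite (arclen_cat _ u0 uv) // addrC addKr.
    by rewrite ger0_norm ?arclen_ge0.
  apply: le_trans (chord_le_arclen (x := gam u) (r := d / sc1) u0 uv v1 _) _;
    last by rewrite ler_wpM2l.
  move=> t /andP[ut tv]; rewrite -opprB norm2N.
  have t1 := le_trans tv v1.
  apply: le_trans (norm2_le_arclen u0 ut t1) _.
  rewrite ler_pM2r ?invr_gt0 //; apply: le_trans E.
  by rewrite (arclen_cat u0 ut tv v1) lerDl arclen_ge0.
have E : arclen v u <= d.
  move: hd; rewrite (arclen_cat _ v0 vu) // opprD addrA subrr sub0r normrN.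
  by rewrite ger0_norm ?arclen_ge0.
have -> : mnorm H (gam u) (gam v - gam u) = mnorm H (gam u) (gam u - gam v).
  rewrite /mnorm -opprB; congr Num.sqrt.
  by rewrite -[LHS]/(qf _ _ _) qfNl qfNr opprK.
apply: le_trans (chord_le_arclen (x := gam u) (r := d / sc1) v0 vu u1 _) _;
  last by rewrite ler_wpM2l.
move=> t /andP[vt tu].
have t0 := le_trans v0 vt.
apply: le_trans (norm2_le_arclen t0 tu u1) _.
rewrite ler_pM2r ?invr_gt0 //; apply: le_trans E.
by rewrite (arclen_cat v0 vt tu u1) lerDr arclen_ge0.
Qed.

Lemma arclen_IVT (l : R) : 0 <= l <= arclen 0 1 ->
  exists2 t, 0 <= t <= 1 & arclen 0 t = l.
Proof.
move=> /andP[l0 l1].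
have A0 : arclen 0 0 = 0 by rewrite /arclen set_itv1 Rintegral_set1.
have [i01 _] := pieces_chain Hcont Pgam (lexx 0) ler01 (lexx 1).
have [||t] := @IVT R (arclen 0) 0 1 l ler01 _ _.
- exact: (parameterized_integral_continuous ler01 i01).
- by rewrite A0 (min_idPl _) ?arclen_ge0 // (max_idPr _) ?arclen_ge0 // l0.
- by rewrite in_itv /= => ht E; exists t.
Qed.

Lemma equal_arclen_sampling (N : nat) : (0 < N)%N ->
  exists q : nat -> 'cV[R]_D, [/\ q 0%N = gam 0, q N = gam 1 &
    forall n, (n < N)%N ->
      mnorm H (q n) (q n.+1 - q n) <=
        (1 + K * (Lg H gam / N%:R / sc1)) * (Lg H gam / N%:R)].
Proof.
move=> N0; have Np : 0 < N%:R :> R by rewrite ltr0n.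
pose L := arclen 0 1; have LE : Lg H gam = L by [].
have L0 : 0 <= L by exact: arclen_ge0.
have A0 : arclen 0 0 = 0 by rewrite /arclen set_itv1 Rintegral_set1.
(* The first and last times are prescribed, which keeps the endpoints of the curve; the intermediate
   value theorem gives the others, and indices beyond [N] receive a dummy time. *)
have ex n : exists t, (n <= N)%N ->
    [/\ 0 <= t <= 1, arclen 0 t = n%:R / N%:R * L, n = 0%N -> t = 0 &
        n = N -> t = 1].
  have [->|n0] := eqVneq n 0%N.
    exists 0 => _; split=> //; rewrite ?lexx ?ler01 ?mul0r //.
    by move=> NE; move: N0; rewrite -NE.
  have [->|nN] := eqVneq n N.
    exists 1 => _; split=> //; rewrite ?lexx ?ler01 ?divff ?mul1r // ?lt0r_neq0 //.
    by move=> NE; move: N0; rewrite NE.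
  have [le_nN|gt] := leqP n N; last by exists 0.
  have [|t ht tE] := @arclen_IVT (n%:R / N%:R * L).
    rewrite mulr_ge0 ?divr_ge0 //= ler_piMl // ler_pdivrMr // mul1r.
    by rewrite ler_nat.
  by exists t => _; split=> // /eqP; [rewrite (negPf n0)|rewrite (negPf nN)].
have [s hs] := choice ex.
exists (gam \o s); split=> /=.
- by have [_ _ -> //] := hs 0%N (leq0n N).
- by have [_ _ _ -> //] := hs N (leqnn N).
- move=> n nN; have [h1 h2 _ _] := hs n (ltnW nN); have [h3 h4 _ _] := hs n.+1 nN.
  rewrite LE; apply: chord_le => //; rewrite h2 h4 -mulrBl -mulrBl -natrB //.
  by rewrite subSnn mul1r mulrC ger0_norm // divr_ge0.
Qed.

(** Each discrete velocity is [N] times a chord of metric norm at most [A * (L / N)], so every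
    summand of the energy is at most [(A * L) ^+ 2], and so is their mean. *)
Lemma El_sampling (N : nat) : (0 < N)%N ->
  exists q : nat -> 'cV[R]_D, [/\ q 0%N = gam 0, q N = gam 1 &
    El H N q <= ((1 + K * (Lg H gam / N%:R / sc1)) * Lg H gam) ^+ 2].
Proof.
move=> N0; have Np : 0 < N%:R :> R by rewrite ltr0n.
have [q [q0 q1 hq]] := equal_arclen_sampling N0; exists q; split => //.
set A := 1 + _ in hq *; set L := Lg H gam in hq *.
rewrite /El ler_pdivrMl // big_mkord.
apply: (@le_trans _ _ (\sum_(n < N) (A * L) ^+ 2)); last first.
  by rewrite sumr_const card_ord mulr_natl.
apply: ler_sum => n _; have := hq n (ltn_ord n).
rewrite -[gmet _ _ _ _]/(qf _ _ _) /betap qfZ2 -[qf _ _ _]/(gmet H _ _ _).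
rewrite -(sqr_mnorm hc1 Hell) -exprMn => hn.
have m0 := mnorm_ge0 H (q n) (q n.+1 - q n).
have AL : 0 <= A * L.
  have := le_trans m0 hn.
  by rewrite mulrA pmulr_lge0 // invr_gt0.
rewrite ler_sqr ?nnegrE ?(mulr_ge0 (ltW Np)) //.
apply: (@le_trans _ _ (N%:R * (A * (L / N%:R)))); first by rewrite ler_pM2l.
by rewrite (_ : N%:R * _ = A * L) //; field; exact: lt0r_neq0.
Qed.

End OneCurve.

(** A single summand of the energy is kept and bounded below by ellipticity. *)
Lemma El_ge_step (N : nat) (gp : nat -> 'cV[R]_D) (n : nat) : (n < N)%N ->
  c1 * N%:R * norm2 (gp n.+1 - gp n) ^+ 2 <= El H N gp.
Proof.
move=> nN; have Np : 0 < N%:R :> R by rewrite ltr0n (leq_ltn_trans _ nN).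
rewrite /El ler_pdivlMl // big_mkord (bigD1 (Ordinal nN)) //=.
apply: (@le_trans _ _ (gmet H (gp n) (betap N gp n) (betap N gp n))); last first.
  by rewrite lerDl sumr_ge0 // => i _; exact: gmet_ge0 hc1 Hell _ _.
have /andP[h _] := Hell (gp n) (betap N gp n); apply: le_trans h.
rewrite /betap norm2Z exprMn ger0_norm ?(ltW Np) // le_eqVlt; apply/orP; left.
by apply/eqP; ring.
Qed.

Lemma Lg_interp_le (N : nat) (gp : nat -> 'cV[R]_D) (r : R) : (0 < N)%N ->
  (forall n, (n < N)%N -> norm2 (gp n.+1 - gp n) <= r) ->
  Lg H (interp N gp) ^+ 2 <= (1 + K * r) ^+ 2 * El H N gp.
Proof.
move=> N0 hr; have Np : 0 < N%:R :> R by rewrite ltr0n.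
have r0 : 0 <= r := le_trans (norm2_ge0 _) (hr 0%N N0).
have A0 : 0 <= 1 + K * r by rewrite addr_ge0 // mulr_ge0.
have P := pieces_interp gp N0.
pose a n := mnorm H (gp n) (betap N gp n).
(* Induction over the nodes. In a cell the velocity is constantly [betap N gp m], and the current
   point is within [r] of [gp m], so the speed is at most [(1 + K * r) * a m]. *)
have steps m : (m <= N)%N -> arclen (interp N gp) 0 (m%:R / N%:R) <=
    (1 + K * r) * (N%:R^-1 * \sum_(0 <= n < m) a n).
  elim: m => [_|m IH mN].
    by rewrite mul0r big_geq // !mulr0 /arclen set_itv1 Rintegral_set1.
  have m0 : 0 <= m%:R / N%:R :> R by rewrite divr_ge0.
  have mm : m%:R / N%:R <= m.+1%:R / N%:R :> R.
    by rewrite ler_pM2r ?invr_gt0 // ler_nat.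
  have m1 : m.+1%:R / N%:R <= 1 :> R by rewrite ler_pdivrMr // mul1r ler_nat.
  rewrite (arclen_cat P (lexx 0) m0 mm m1) big_nat_recr //= !mulrDr.
  apply: lerD; first exact/IH/ltnW.
  have E t : m%:R / N%:R <= t <= m.+1%:R / N%:R -> interp N gp t =
    gp m + (N%:R * t - m%:R) *: (gp m.+1 - gp m) by exact: interp_affine.
  have [iF _] := pieces_chain Hcont P m0 mm m1.
  apply: le_trans (Rintegral_le_cst (M := (1 + K * r) * a m) mm iF _) _; last first.
    rewrite -mulrBl -natrB // subSnn mul1r -mulrA [a m * _]mulrC //.
  move=> t tm; have Caff := C1_affine (gp m) (gp m.+1 - gp m) N%:R m%:R.
  rewrite (speed_piece H E tm) /speed derive_affine.
  apply: (mnorm_lipschitz hc1 hLH Hell Hlip).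
  rewrite addrC addKr norm2Z; move: tm => /andP[t1 t2].
  rewrite ltr_pdivrMr // in t1; rewrite ltr_pdivlMr // -natr1 in t2.
  apply: le_trans (hr m mN); rewrite ler_piMl ?norm2_ge0 // ger0_norm; lra.
have L0 : 0 <= Lg H (interp N gp) by exact: arclen_ge0.
have := steps N (leqnn N); rewrite divff ?lt0r_neq0 // -[arclen _ _ _]/(Lg H _).
move=> hL; apply: (@le_trans _ _
  (((1 + K * r) * (N%:R^-1 * \sum_(0 <= n < N) a n)) ^+ 2)).
  by rewrite ler_sqr ?nnegrE // (le_trans L0).
rewrite exprMn ler_wpM2l ?sqr_ge0 //; apply: le_trans (sqr_mean_le _ N0) _.
rewrite /El ler_pM2l ?invr_gt0 // le_eqVlt; apply/orP; left; apply/eqP.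
by apply: eq_bigr => n _; exact: sqr_mnorm hc1 Hell _ _.
Qed.

End Lengths.

(** Linearizes the square using e^2 <= e. *)
Lemma sqr_perturb {R : realType} (x e : R) : 0 <= x -> 0 <= e <= 1 ->
  (1 + x * e) ^+ 2 <= 1 + (2 * x + x ^+ 2) * e.
Proof.
move=> x0 /andP[e0 e1]; rewrite -subr_ge0.
rewrite (_ : _ - _ = x ^+ 2 * (e * (1 - e))); last by ring.
by rewrite mulr_ge0 ?sqr_ge0 // mulr_ge0 // subr_ge0.
Qed.

(** * The rate against one competitor of length at most [B] *)

Section Rate.
Context {R : realType} {D : nat}.
Variables (c1 LH B : R).

Let K := LH / c1.
(** With e = N^(-1/2): [a * e] bounds the relative sampling error, [E0] the energy of every discrete
    minimizer, and [m * e] the Euclidean size of its steps. *)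
Let a := K * (B / Num.sqrt c1).
Let E0 := ((1 + a) * B) ^+ 2.
Let m := Num.sqrt (E0 / c1).

(** The first term is the sampling error in the discrete energy, the second the cost of unfreezing
    the metric along the interpolation. *)
Definition rate_const : R :=
  B ^+ 2 * (2 * a + a ^+ 2) + (2 * (K * m) + (K * m) ^+ 2) * E0.

Lemma argmin_interp_length (c2 : R) (X0 X1 : set 'cV[R]_D)
    (H : 'cV[R]_D -> 'M[R]_D) (N : nat) (gp : nat -> 'cV[R]_D)
    (gam : R -> 'cV[R]_D) :
  0 < c1 -> 0 <= LH -> continuous H ->
  (forall x, (H x)^T = H x) ->
  (forall x u, c1 * norm2 u ^+ 2 <= gmet H x u u <= c2 * norm2 u ^+ 2) ->
  (forall x y, opnorm (H x - H y) <= LH * norm2 (x - y)) ->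
  (0 < N)%N -> is_argmin_El H N X0 X1 gp ->
  pieces gam -> X0 (gam 0) -> X1 (gam 1) -> Lg H gam <= B ->
  Lg H (interp N gp) ^+ 2 <= Lg H gam ^+ 2 + rate_const / Num.sqrt N%:R.
Proof.
move=> hc1 hLH Hcont Hsym Hell Hlip N0 [_ gpmin] Pgam X0g X1g LB.
have Np : 0 < N%:R :> R by rewrite ltr0n.
have K0 : 0 <= K by rewrite divr_ge0 // ltW.
have sc1p : 0 < Num.sqrt c1 by rewrite sqrtr_gt0.
set L := Lg H gam in LB *.
have L0 : 0 <= L by exact: arclen_ge0.
have B0 : 0 <= B := le_trans L0 LB.
have a0 : 0 <= a by rewrite mulr_ge0 // divr_ge0 // ltW.
have m0 : 0 <= m by exact: sqrtr_ge0.
have Km0 : 0 <= K * m by rewrite mulr_ge0.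
pose e := (Num.sqrt N%:R)^-1 : R.
have N1 : 1 <= N%:R :> R by rewrite ler1n.
have sN1 : 1 <= Num.sqrt N%:R :> R by rewrite -[leLHS]sqrtr1 ler_wsqrtr.
have sN0 : 0 < Num.sqrt N%:R :> R := lt_le_trans ltr01 sN1.
have e0 : 0 <= e by rewrite invr_ge0 ltW.
have e1 : e <= 1 by rewrite invf_le1.
have e2 : e ^+ 2 = N%:R^-1 by rewrite exprVn sqr_sqrtr // ltW.
have e01 : 0 <= e <= 1 by rewrite e0.
have [q [q0 q1 Eq]] := El_sampling hc1 hLH Hcont Hsym Hell Hlip Pgam N0.
set E := El H N gp.
have E_le : E <= ((1 + a * e) * L) ^+ 2.
  have qX : Cp N X0 X1 q by split; rewrite ?q0 ?q1.
  apply: le_trans (gpmin q qX) _; apply: le_trans Eq _; rewrite -/L.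
  (* Sampling gains 1/N = e^2; one factor e <= 1 is given up to match the final rate. *)
  have aL : LH / c1 * (L / N%:R / Num.sqrt c1) <= a * e.
    rewrite -/K /a -[leRHS]mulrA ler_wpM2l // -e2 mulrAC expr2 ler_pM //.
    - by rewrite divr_ge0 // ltW.
    - by rewrite mulr_ge0.
    - by rewrite ler_pM2r ?invr_gt0.
    - by rewrite -[leRHS]mul1r ler_wpM2r.
  have aL0 : 0 <= LH / c1 * (L / N%:R / Num.sqrt c1).
    by rewrite mulr_ge0 // !divr_ge0 // ltW.
  have [b1 b2] : 0 <= 1 + LH / c1 * (L / N%:R / Num.sqrt c1) /\ 0 <= 1 + a * e.
    by rewrite !addr_ge0 ?(mulr_ge0 a0).
  by rewrite ler_sqr ?nnegrE ?(mulr_ge0 b1) ?(mulr_ge0 b2) // ler_wpM2r // lerD2l.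
have E_E0 : E <= E0.
  have [b1 b2] : 0 <= 1 + a * e /\ 0 <= 1 + a.
    by rewrite !addr_ge0 ?(mulr_ge0 a0).
  apply: le_trans E_le _.
  by rewrite ler_sqr ?nnegrE ?(mulr_ge0 b1) ?(mulr_ge0 b2) // ler_pM // lerD2l ler_piMr.
have E00 : 0 <= E0 by exact: sqr_ge0.
have E_L : E <= L ^+ 2 + B ^+ 2 * (2 * a + a ^+ 2) * e.
  apply: le_trans E_le _; rewrite exprMn.
  apply: (@le_trans _ _ ((1 + (2 * a + a ^+ 2) * e) * L ^+ 2)).
    by rewrite ler_wpM2r ?sqr_ge0 // sqr_perturb.
  rewrite mulrDl mul1r lerD2l mulrC -mulrA ler_wpM2r //.
    by rewrite mulr_ge0 // addr_ge0 ?sqr_ge0 // mulr_ge0.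
  by rewrite ler_sqr ?nnegrE.
have step n : (n < N)%N -> norm2 (gp n.+1 - gp n) <= m * e.
  move=> nN; have := le_trans (El_ge_step hc1 Hell gp nN) E_E0.
  have cN : 0 < c1 * N%:R by rewrite mulr_gt0.
  rewrite mulrC -ler_pdivlMr // => h.
  rewrite -ler_sqr ?nnegrE ?norm2_ge0 ?mulr_ge0 //; apply: le_trans h _.
  rewrite exprMn e2 sqr_sqrtr; last by rewrite divr_ge0 // ltW.
  by rewrite invfM mulrA.
apply: le_trans (Lg_interp_le hc1 hLH Hcont Hell Hlip N0 step) _.
rewrite -/K -/E [K * (m * e)]mulrA.
have E_ge0 : 0 <= E.
  rewrite mulr_ge0 ?invr_ge0 ?(ltW Np) // sumr_ge0 // => n _.
  exact: gmet_ge0 hc1 Hell _ _.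
clearbody E.
apply: (@le_trans _ _ ((1 + (2 * (K * m) + (K * m) ^+ 2) * e) * E)).
  by rewrite ler_wpM2r // sqr_perturb.
rewrite mulrDl mul1r /rate_const -/e [X in _ <= _ + X]mulrDl addrA lerD //.
rewrite mulrAC ler_wpM2r // ler_wpM2l //.
by rewrite addr_ge0 ?sqr_ge0 // mulr_ge0.
Qed.

End Rate.

(** * The straight segment as reference competitor *)

Section Segment.
Context {R : realType} {D : nat}.
Variables (x0 x1 : 'cV[R]_D).

(** The redundant [1 * t - 0] puts the segment in the affine form of [C1_affine]. *)
Definition segment_curve (t : R) : 'cV[R]_D := x0 + (1 * t - 0) *: (x1 - x0).

Lemma segment_curve0 : segment_curve 0 = x0.
Proof. by rewrite /segment_curve mulr0 subr0 scale0r addr0. Qed.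

Lemma segment_curve1 : segment_curve 1 = x1.
Proof. by rewrite /segment_curve mulr1 subr0 scale1r addrC subrK. Qed.

Lemma piecewise_C1_segment : piecewise_C1 segment_curve.
Proof.
have C := C1_affine x0 (x1 - x0) 1 0; split.
  by apply: continuous_subspaceT; exact: C1_curve_continuous.
exists [:: 1]; split=> //=; first by rewrite ltr01.
by case=> // _; exists segment_curve.
Qed.

Lemma Lg_segment (c1 c2 : R) (H : 'cV[R]_D -> 'M[R]_D) :
  0 <= c2 -> continuous H ->
  (forall x u, c1 * norm2 u ^+ 2 <= gmet H x u u <= c2 * norm2 u ^+ 2) ->
  Lg H segment_curve <= Num.sqrt c2 * norm2 (x1 - x0).
Proof.
move=> c20 Hcont Hell.
have P := piecewise_C1_pieces piecewise_C1_segment.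
have [i01 _] := pieces_chain Hcont P (lexx 0) ler01 (lexx 1).
apply: le_trans (Rintegral_le_cst (M := Num.sqrt c2 * norm2 (x1 - x0)) ler01 i01 _) _.
  move=> t _; rewrite /speed derive_affine scale1r.
  exact: mnorm_le_norm2 Hell _ _ c20.
by rewrite subr0 mulr1.
Qed.

End Segment.

(** * Passage from single competitors to the infimum *)

Unset Implicit Arguments.

Theorem theorem1p4 (R : realType) (D : nat) (hD : (1 <= D)%N)
  (c1 c2 LH : R) (hc1 : 0 < c1) (hc2 : 0 < c2) (hLH : 0 <= LH)
  (X0 X1 : set 'cV[R]_D)
  (hX0ne : X0 !=set0) (hX1ne : X1 !=set0)
  (hX0cl : closed X0) (hX1cl : closed X1)
  (hbdd : bounded_set X0 \/ bounded_set X1)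
  (dval : R) :
  exists C : R,
    forall H : 'cV[R]_D -> 'M[R]_D,
      smooth_field H ->
      (forall x, (H x)^T = H x) ->
      (forall x u, c1 * norm2 u ^+ 2 <= gmet H x u u <= c2 * norm2 u ^+ 2) ->
      (forall x y, opnorm (H x - H y) <= LH * norm2 (x - y)) ->
      dg_set H X0 X1 = dval ->
      forall (N : nat), (1 <= N)%N ->
      forall gp : nat -> 'cV[R]_D, is_argmin_El H N X0 X1 gp ->
        Lg H (interp N gp) ^+ 2
          - inf [set Lg H gam ^+ 2 | gam in Cps X0 X1]
        <= C / Num.sqrt (N%:R).
Proof.
have [x0 X0x0] := hX0ne; have [x1 X1x1] := hX1ne.
(* Bounds the length of the segment from [x0] to [x1] in every admissible metric, so the constant
   can be fixed before [H]. *)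
pose B := Num.sqrt c2 * norm2 (x1 - x0).
exists (rate_const c1 LH B) => H Hsmooth Hsym Hell Hlip _ N N1 gp gpmin.
have Hcont : continuous H.
  by move=> x; apply: differentiable_continuous; exact: (Hsmooth [::] x).
have bound gam : Cps X0 X1 gam -> Lg H gam <= B ->
    Lg H (interp N gp) ^+ 2 <= Lg H gam ^+ 2 + rate_const c1 LH B / Num.sqrt N%:R.
  move=> [/piecewise_C1_pieces Pgam [X0g X1g]].
  exact: (argmin_interp_length hc1 hLH Hcont Hsym Hell Hlip N1 gpmin Pgam X0g X1g).
have Cseg : Cps X0 X1 (segment_curve x0 x1).
  split; first exact: piecewise_C1_segment.
  by rewrite segment_curve0 segment_curve1.
have Lseg : Lg H (segment_curve x0 x1) <= B := Lg_segment x0 x1 (ltW hc2) Hcont Hell.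
(* It suffices to compare with each competitor separately; the segment shows that the set of squared
   lengths is nonempty. *)
rewrite lerBlDr -lerBlDl; apply: lb_le_inf.
  by exists (Lg H (segment_curve x0 x1) ^+ 2); exists (segment_curve x0 x1).
move=> _ [gam Cgam <-]; rewrite lerBlDl addrC.
(* A competitor longer than [B] is also longer than the segment, so the estimate for the segment
   covers it. *)
have [LB|BL] := leP (Lg H gam) B; first exact: bound.
apply: le_trans (bound _ Cseg Lseg) _; rewrite lerD2r.
have sqr_mono (x y : R) : 0 <= x -> x <= y -> x ^+ 2 <= y ^+ 2.
  by move=> x_ge0 xy; rewrite ler_sqr ?nnegrE // (le_trans x_ge0).
have L0 : 0 <= Lg H (segment_curve x0 x1) by exact: arclen_ge0.
have le_seg : Lg H (segment_curve x0 x1) <= Lg H gam.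
  exact: le_trans Lseg (ltW BL).
exact: sqr_mono L0 le_seg.
Qed.
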